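(* Let $\mathcal{G}=\langle\mathcal{H},\mathcal{E}\rangle$ be a quantum Markov chain and $X$ a subspace of $\mathcal{H}$. Then $X$ is a bottom strongly connected component (BSCC) of $\mathcal{G}$ if and only if there exists a minimal fixed point state $\rho$ of $\mathcal{E}$ such that $\mathrm{supp}(\rho)=X$. Furthermore, in this case $\rho$ is the unique fixed point state of $\mathcal{E}$, up to normalisation (i.e. up to a positive scalar factor), whose support is included in $X$.
   Context: $\mathcal{H}$ is a (nonzero) finite-dimensional complex Hilbert space. $\mathcal{D}(\mathcal{H})$ is the set of partial density operators: positive semidefinite operators $\rho$ with $\mathrm{tr}(\rho)\le 1$. A density operator has trace $1$; a pure state is a unit vector $|\psi\rangle$, and $\psi=|\psi\rangle\langle\psi|$. $\mathrm{supp}(\rho)$ is the span of the eigenvectors of $\rho$ with nonzero eigenvalue. $\bigvee$ denotes the span of a union of subspaces, $P_X$ the orthogonal projection onto $X$. A quantum Markov chain is a pair $\langle\mathcal{H},\mathcal{E}\rangle$ with $\mathcal{E}$ a trace-preserving completely positive linear map on the operators on $\mathcal{H}$. For a completely positive map $\mathcal{F}$ and a subspace $X$, the image is $\mathcal{F}(X)=\bigvee_{|\psi\rangle\in X}\mathrm{supp}(\mathcal{F}(\psi))$. $X$ is invariant in $\langle\mathcal{H},\mathcal{E}\rangle$ if $\mathcal{E}(X)\subseteq X$. For a chain $\langle\mathcal{K},\mathcal{F}\rangle$ ($\mathcal{F}$ completely positive and trace-nonincreasing on $\mathcal{K}$), a path is a sequence of density operators $\rho_0\to\rho_1\to\cdots\to\rho_n$,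 $n\ge 0$, with $\mathrm{supp}(\rho_{i+1})\subseteq\mathcal{F}(\mathrm{supp}(\rho_i))$ for each $i$. For a pure state $|\psi\rangle$, the reachable space $\mathcal{R}_{\langle\mathcal{K},\mathcal{F}\rangle}(\psi)$ is the span of all pure states $|\varphi\rangle$ such that there is a path from $\psi$ to $\varphi$; equivalently $\bigvee_{i\ge 0}\mathrm{supp}(\mathcal{F}^i(\psi))$. For a subspace $X$, the restriction is $\mathcal{G}_X=\langle X,\mathcal{E}|_X\rangle$ with $\mathcal{E}|_X(\rho)=P_X\mathcal{E}(\rho)P_X$. $X$ is strongly connected in $\mathcal{G}$ if for all pure states $|\varphi\rangle,|\psi\rangle\in X$ one has $|\varphi\rangle\in\mathcal{R}_{\mathcal{G}_X}(\psi)$ and $|\psi\rangle\in\mathcal{R}_{\mathcal{G}_X}(\varphi)$. A strongly connected component (SCC) is a strongly connected subspace that is maximal with respect to $\subseteq$. A BSCC is an SCC that is invariant. A fixed point state of $\mathcal{E}$ is a nonzero $\rho\in\mathcal{D}(\mathcal{H})$ with $\mathcal{E}(\rho)=\rho$. A fixed point state $\rho$ is minimal if for every fixed point state $\sigma$ of $\mathcal{E}$, $\mathrm{supp}(\sigma)\subseteq\mathrm{supp}(\rho)$ implies that $\sigma$ equals $\rho$ up to normalisation (a positive scalar factor). *)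

(* Defs.v *)
(* MathComp / MathComp-Analysis.

   The Hilbert space is C^n with C = R[i] for a realType R and the standard
   inner product [dotmx] (linear on the left, antilinear on the right).

   Vectors are row vectors and operators act on them by right multiplication,
   v |-> v *m A, which is the convention of mxalgebra.v and spectral.v: the
   matrix written here for an operator is the transpose of its usual matrix on
   column vectors.  A subspace of C^n is the row space of a square matrix, and
   is compared with others only through the %MS relations. *)
From HB Require Import structures.
From mathcomp Require Import all_boot all_order all_algebra.
From mathcomp Require Import boolp classical_sets reals complex.

Set Implicit Arguments.
Unset Strict Implicit.
Unset Printing Implicit Defensive.

Import Order.TTheory GRing.Theory Num.Theory.
Local Open Scope classical_set_scope.
Local Open Scope complex_scope.
Local Open Scope ring_scope.
Local Open Scope sesquilinear_scope.

Section Span.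
Context {F : fieldType} {n : nat}.
Implicit Types (S : set 'rV[F]_n) (U W : 'M[F]_n).

Definition is_span S U : Prop :=
  (forall v, S v -> (v <= U)%MS) /\
  (forall W, (forall v, S v -> (v <= W)%MS) -> (U <= W)%MS).

Lemma span_exists S : exists U, is_span S U.
Proof.
pose Q (W : 'M[F]_n) := forall v, S v -> (v <= W)%MS.
pose p k := `[< exists2 W, Q W & \rank W = k >].
have exp : exists k, p k.
  exists n; apply/asboolP; exists 1%:M; last exact: mxrank1.
  by move=> v _; exact: submx1.
have [k /asboolP[U QU <-] kmin] := ex_minnP exp.
exists U; split=> // W QW.
have QUW : Q (U :&: W)%MS by move=> v Sv; rewrite sub_capmx QU ?QW.
have /kmin rk : p (\rank (U :&: W)%MS) by apply/asboolP; exists (U :&: W)%MS.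
have := geq_leqif (mxrank_leqif_sup (capmxSl U W)); rewrite rk => /esym.
by rewrite sub_capmx => /andP[].
Qed.

Definition mxspan S : 'M[F]_n := projT1 (cid (span_exists S)).

Lemma mxspanP S : is_span S (mxspan S).
Proof. exact: projT2 (cid (span_exists S)). Qed.

End Span.

Section States.
Context {R : realType}.
Local Notation C := R[i].

(* In R[i], [0 <= z] means that z is real and nonnegative; hence a matrix
   satisfying [psdmx] is Hermitian. *)
Definition psdmx m (A : 'M[C]_m) : Prop :=
  forall v : 'rV[C]_m, 0 <= dotmx (v *m A) v.

Context {n : nat}.
Implicit Types (rho sigma : 'M[C]_n) (phi psi : 'rV[C]_n).

Definition partial_density rho : Prop := psdmx rho /\ \tr rho <= 1.

Definition density rho : Prop := psdmx rho /\ \tr rho = 1.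

Definition pure_state psi : Prop := dotmx psi psi = 1.

(* |psi><psi|, that is, v |-> <psi|v> psi *)
Definition ketbra psi : 'M[C]_n := psi ^t* *m psi.

Definition supp rho : 'M[C]_n :=
  mxspan [set v | exists2 a, a != 0 & (v <= eigenspace rho a)%MS].

End States.

Section Maps.
Context {R : realType} {n : nat}.
Local Notation C := R[i].
Implicit Types (E F : 'M[C]_n -> 'M[C]_n) (K X Y : 'M[C]_n).
Implicit Types (rho sigma : 'M[C]_n) (phi psi : 'rV[C]_n).

(* id_k (x) E on the operators on C^k (x) C^n, seen as k x k block matrices
   with blocks of size n *)
Definition ampliation k E (M : 'M[C]_(\sum_(i < k) n)) :
    'M[C]_(\sum_(i < k) n) :=
  \mxblock_(i < k, j < k) E (submxblock M i j).

Definition completely_positive E : Prop :=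
  forall k (M : 'M[C]_(\sum_(i < k) n)), psdmx M -> psdmx (ampliation E M).

Definition trace_preserving E : Prop := forall A : 'M[C]_n, \tr (E A) = \tr A.

Definition superop_image F X : 'M[C]_n :=
  mxspan [set v | exists2 psi, pure_state psi /\ (psi <= X)%MS &
                    (v <= supp (F (ketbra psi)))%MS].

Definition invariant_space E X : Prop := (superop_image E X <= X)%MS.

(* A chain <K, F> on a subspace K of C^n: the operators on K are identified
   with the operators A on C^n such that A = P_K A P_K, so that the density
   operators on K are the density operators on C^n supported in K. *)
Definition density_on K rho : Prop := density rho /\ (supp rho <= K)%MS.

Definition path_between K F rho sigma : Prop :=
  exists (l : nat) (s : nat -> 'M[C]_n),
    [/\ s 0%N = rho, s l = sigma,
        forall i, (i <= l)%N -> density_on K (s i) &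
        forall i, (i < l)%N ->
          (supp (s i.+1) <= superop_image F (supp (s i)))%MS].

Definition reachable K F psi : 'M[C]_n :=
  mxspan [set phi | pure_state phi /\
                    path_between K F (ketbra psi) (ketbra phi)].

Definition restriction X E rho : 'M[C]_n :=
  proj_ortho X *m E rho *m proj_ortho X.

Definition strongly_connected E X : Prop :=
  forall phi psi, pure_state phi -> pure_state psi ->
    (phi <= X)%MS -> (psi <= X)%MS ->
    (phi <= reachable X (restriction X E) psi)%MS /\
    (psi <= reachable X (restriction X E) phi)%MS.

Definition SCC E X : Prop :=
  strongly_connected E X /\
  forall Y, strongly_connected E Y -> (X <= Y)%MS -> (Y <= X)%MS.

Definition BSCC E X : Prop := SCC E X /\ invariant_space E X.

Definition fixed_point_state E rho : Prop :=
  [/\ rho != 0, partial_density rho & E rho = rho].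

(* In R[i], [0 < c] means that c is real and positive. *)
Definition eq_upto_scaling sigma rho : Prop :=
  exists2 c : C, 0 < c & sigma = c *: rho.

Definition minimal_fixed_point_state E rho : Prop :=
  fixed_point_state E rho /\
  forall sigma, fixed_point_state E sigma -> (supp sigma <= supp rho)%MS ->
    eq_upto_scaling sigma rho.

End Maps.

(* Main.v *)
(* A fixed point state supported in a strongly connected X has support X, since
   its support is invariant and so contains everything reachable from it.
   Two fixed point states of full support are proportional: subtract from one
   the largest multiple of the other that keeps it positive.

   Conversely, for a minimal fixed point state with support X and a pure state
   psi of X, the orbit E^i(psi) stays in the space reachable from psi, and its
   ergodic limit is a fixed point state supported there; by minimality its
   support is X.  The ergodic limit is obtained without compactness: the orbits
   of E are bounded, so E - 1 has no nilpotent part at 0 and psi splits as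
   s + (E w - w) with E s = s; then s differs from the Cesaro means of the orbit
   by O(1/N), hence is positive. *)
Require Import Defs.
From HB Require Import structures.
From mathcomp Require Import all_boot all_order all_algebra.
From mathcomp Require Import boolp classical_sets reals complex.
From mathcomp Require Import ring.

Set Implicit Arguments.
Unset Strict Implicit.
Unset Printing Implicit Defensive.

Import Order.TTheory GRing.Theory Num.Theory.

Local Open Scope complex_scope.
Local Open Scope ring_scope.
Local Open Scope sesquilinear_scope.

Local Notation "B ^!" :=
  (orthomx Num.Def.conjC (mx_of_hermitian (hermitian1mx _)) B) : matrix_set_scope.

Lemma row_diag_mul (S : comPzSemiRingType) m n (d : 'rV[S]_m) (A : 'M[S]_(m, n)) i :
  row i (diag_mx d *m A) = d 0 i *: row i A.
Proof. by rewrite mul_diag_mx; apply/rowP => j; rewrite !mxE. Qed.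

(** * Conjugate transposes, quadratic forms and orthogonal projections *)

Section ConjugateTranspose.
Context {C : numClosedFieldType}.

Lemma trmxC_mul m n p (A : 'M[C]_(m, n)) (B : 'M[C]_(n, p)) :
  (A *m B)^t* = B^t* *m A^t*.
Proof. by rewrite trmx_mul map_mxM. Qed.

Lemma trmxCD m n (A B : 'M[C]_(m, n)) : (A + B)^t* = A^t* + B^t*.
Proof. by rewrite linearD map_mxD. Qed.

Lemma trmxCZ m n a (A : 'M[C]_(m, n)) : (a *: A)^t* = a^* *: A^t*.
Proof. by rewrite linearZ map_mxZ. Qed.

Lemma dotmx_ge0 n (u : 'rV[C]_n) : 0 <= dotmx u u.
Proof. exact: dnorm_ge0. Qed.

Lemma dotmx_eq0 n (u : 'rV[C]_n) : (dotmx u u == 0) = (u == 0).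
Proof. exact: dnorm_eq0. Qed.

Lemma dotmxZZ n a (u : 'rV[C]_n) : dotmx (a *: u) (a *: u) = `|a| ^+ 2 * dotmx u u.
Proof.
by rewrite !dotmxE trmxCZ -scalemxAl -scalemxAr scalerA mxE -normCK.
Qed.

Lemma dotmxMl m n (u : 'rV[C]_m) (A : 'M[C]_(m, n)) (v : 'rV[C]_n) :
  dotmx (u *m A) v = dotmx u (v *m A^t*).
Proof. by rewrite !dotmxE trmxC_mul trmxCK mulmxA. Qed.

Lemma dotmx_sum n (u : 'rV[C]_n) : dotmx u u = \sum_i `|u 0 i| ^+ 2.
Proof.
by rewrite dotmxE mxE; apply: eq_bigr => i _; rewrite !mxE normCK.
Qed.

(** Cauchy-Schwarz for each row of [W]; the trace is the squared Hilbert-Schmidt norm of [W]. *)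
Lemma dotmx_mul_le m n (x : 'rV[C]_n) (W : 'M[C]_(m, n)) :
  dotmx (x *m W^t*) (x *m W^t*) <= \tr (W *m W^t*) * dotmx x x.
Proof.
rewrite dotmx_sum /mxtrace mulr_suml; apply: ler_sum => i _.
have -> : (x *m W^t*) 0 i = dotmx x (row i W).
  by rewrite dotmxE !mxE; apply: eq_bigr => j _; rewrite !mxE.
have -> : (W *m W^t*) i i = dotmx (row i W) (row i W).
  by rewrite dotmxE !mxE; apply: eq_bigr => j _; rewrite !mxE.
by rewrite mulrC; have [] := CauchySchwarz (@dotmx C n) x (row i W).
Qed.

(* Polarisation, specific to complex scalars: a rotation by a right angle is
   skew-symmetric over the reals. *)
Lemma quadratic_form_eq0 n (M : 'M[C]_n) :
  (forall v, dotmx (v *m M) v = 0) -> M = 0.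
Proof.
move=> M0.
have B0 (u v : 'rV[C]_n) : (u *m M *m v^t*) 0 0 = 0.
  have z00 a (K : 'M[C]_1) : (a *: K) 0 0 = a * K 0 0 by rewrite mxE.
  have uv0 (w z : 'rV[C]_n) : (w *m M *m z^t*) 0 0 + (z *m M *m w^t*) 0 0 = 0.
    have := M0 (w + z); rewrite dotmxE trmxCD !mulmxDl !mulmxDr mxE.
    rewrite [X in X + _]mxE [X in _ + X]mxE.
    by rewrite -!dotmxE !M0 add0r addr0.
  (* Replacing [v] by ['i *: v] makes the sesquilinear form symmetric, while [uv0 u v] makes it
     skew-symmetric. *)
  have := uv0 u ('i *: v); rewrite trmxCZ -!scalemxAl -scalemxAr !z00.
  rewrite conjCi mulNr addrC => /eqP; rewrite subr_eq0.
    rewrite (inj_eq (mulfI (neq0Ci C))) => /eqP e; have := uv0 u v.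
  by rewrite e -mulr2n => /eqP; rewrite mulrn_eq0 /= => /eqP.
apply/matrixP => i j; rewrite mxE -(B0 (delta_mx 0 i) (delta_mx 0 j)).
by rewrite -rowE trmx_delta map_delta_mx -colE !mxE.
Qed.

Lemma ortho_mul_herm m n (X : 'M[C]_(m, n)) (A : 'M[C]_n) :
  A^t* = A -> (A <= X)%MS -> (X^!)%MS *m A = 0.
Proof. by move=> hA AX; rewrite -[A]hA; apply/orthomx1P; rewrite submx_ortho. Qed.

(** The rows of [1 - proj_ortho X] lie in the orthogonal complement of [X], and a Hermitian [A] with
    rows in [X] sends that complement to 0. So the projection can also be absorbed on the left. *)
Lemma herm_mul_proj_ortho m n (X : 'M[C]_(m, n)) (A : 'M[C]_n) :
  A^t* = A -> (A <= X)%MS -> proj_ortho X *m A = A.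
Proof.
move=> hA AX; apply/eqP; rewrite -subr_eq0 -opprB oppr_eq0 -{1}(mul1mx A).
rewrite -mulmxBl; have /submxP[D eD] := proj_ortho_compl_sub X (1%:M : 'M_n).
by rewrite mul1mx in eD; rewrite eD -mulmxA ortho_mul_herm ?mulmx0.
Qed.

End ConjugateTranspose.

(** * Positive semidefinite matrices, their supports and the Loewner order *)

Section PositiveSemidefinite.
Context {R : realType}.
Local Notation C := R[i].

Lemma qform_gram m n (S : 'M[C]_(m, n)) (v : 'rV[C]_n) :
  dotmx (v *m (S^t* *m S)) v = dotmx (v *m S^t*) (v *m S^t*).
Proof. by rewrite mulmxA dotmxMl. Qed.

Lemma psdmx_gram m n (S : 'M[C]_(m, n)) : psdmx (S^t* *m S).
Proof. by move=> v; rewrite qform_gram dotmx_ge0. Qed.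

Context {n : nat}.
Implicit Types (A B S X Y : 'M[C]_n) (phi psi v : 'rV[C]_n).

Lemma qformD A B v :
  dotmx (v *m (A + B)) v = dotmx (v *m A) v + dotmx (v *m B) v.
Proof. by rewrite !dotmxE mulmxDr mulmxDl mxE. Qed.

Lemma qformZ a A v : dotmx (v *m (a *: A)) v = a * dotmx (v *m A) v.
Proof. by rewrite !dotmxE -scalemxAr -scalemxAl mxE. Qed.

Lemma qformB A B v :
  dotmx (v *m (A - B)) v = dotmx (v *m A) v - dotmx (v *m B) v.
Proof. by rewrite qformD -scaleN1r qformZ mulN1r. Qed.

Lemma psdmxZ a A : 0 <= a -> psdmx A -> psdmx (a *: A).
Proof. by move=> a0 pA v; rewrite qformZ mulr_ge0. Qed.

(** The quadratic form of [A] is real, hence equal to that of the adjoint; by polarisation the two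
    matrices agree. *)
Lemma psdmx_herm A : psdmx A -> A^t* = A.
Proof.
move=> pA; apply/eqP; rewrite eq_sym -subr_eq0; apply/eqP.
apply: quadratic_form_eq0 => v; rewrite qformB; apply/eqP; rewrite subr_eq0.
rewrite [X in _ == X]dotmxMl trmxCK -(geC0_conj (pA v)).
rewrite !dotmxE; apply/eqP.
have -> (M : 'M[C]_1) : (M 0 0)^* = (M^t*) 0 0 by rewrite !mxE.
by rewrite trmxC_mul trmxCK.
Qed.

Lemma supp_sub A : (supp A <= A)%MS.
Proof.
have [_] := mxspanP (fun v : 'rV[C]_n =>
  exists2 a : C, a != 0 & (v <= eigenspace A a)%MS).
apply=> v [a a0 /eigenspaceP vA].
have -> : v = a^-1 *: (v *m A) by rewrite vA scalerA mulVf // scale1r.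
by rewrite scalemx_sub // submxMl.
Qed.

Lemma eigenvector_supp A a v : a != 0 -> v *m A = a *: v -> (v <= supp A)%MS.
Proof.
move=> a0 vA.
have [+ _] := mxspanP (fun v : 'rV[C]_n =>
  exists2 a : C, a != 0 & (v <= eigenspace A a)%MS).
by apply; exists a => //; apply/eigenspaceP.
Qed.

(** By the spectral theorem, [S] can have as rows the eigenvectors scaled by the square roots of
    their eigenvalues. The rows with eigenvalue 0 vanish, the others lie in the support. *)
Lemma psdmx_factor A :
  psdmx A -> exists2 S : 'M[C]_n, A = S^t* *m S & (S <= supp A)%MS.
Proof.
move=> pA; have hA := psdmx_herm pA.
have /orthomx_spectralP : A \is normalmx by apply/normalmxP; rewrite hA.
set U := spectralmx A; set d := spectral_diag A.
have uU : U \is unitarymx by exact: spectral_unitarymx.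
rewrite invmx_unitary // => eA.
have UA i : row i U *m A = d 0 i *: row i U.
  rewrite -row_mul {1}eA !mulmxA (unitarymxP uU) mul1mx.
  by rewrite row_diag_mul.
have Ui i : dotmx (row i U) (row i U) = 1.
  by have /row_unitarymxP -> := uU; rewrite eqxx.
have d0 i : 0 <= d 0 i.
  have := pA (row i U); rewrite UA dotmxE -scalemxAl mxE -dotmxE Ui.
  by rewrite mulr1.
clearbody U d; exists (diag_mx (\row_i sqrtC (d 0 i)) *m U).
  rewrite {1}eA trmxC_mul !mulmxA; congr (_ *m _).
  rewrite -mulmxA; congr (_ *m _).
  rewrite tr_diag_mx map_diag_mx mulmx_diag; congr diag_mx.
  apply/rowP => i; rewrite !mxE -[LHS]sqrtCK expr2.
  by congr (_ * _); apply/esym/geC0_conj; rewrite sqrtC_ge0.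
apply/row_subP => i; rewrite row_diag_mul mxE.
have [->|di0] := eqVneq (d 0 i) 0; first by rewrite sqrtC0 scale0r sub0mx.
by rewrite scalemx_sub // (eigenvector_supp di0).
Qed.

(** Allows supports to be handled as row spaces from here on. Positivity matters: a nonzero
    nilpotent matrix has support 0. *)
Lemma eqmx_supp A : psdmx A -> (supp A :=: A)%MS.
Proof.
move=> /psdmx_factor[S eA sS]; apply/eqmxP; rewrite supp_sub /=.
by apply: submx_trans sS; rewrite {1}eA submxMl.
Qed.

Lemma psdmx_ketbra psi : psdmx (ketbra psi).
Proof. exact: psdmx_gram. Qed.

Lemma ketbra_sub psi : (ketbra psi <= psi)%MS.
Proof. exact: submxMl. Qed.

Lemma sub_ketbra psi : pure_state psi -> (psi <= ketbra psi)%MS.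
Proof.
move=> psi1; have {1}<- : psi *m ketbra psi = psi; last exact: submxMl.
rewrite mulmxA; have -> : psi *m psi^t* = 1%:M.
  by apply/matrixP => i j; rewrite !ord1 -dotmxE psi1 mxE.
by rewrite mul1mx.
Qed.

Lemma mxtrace_ketbra psi : pure_state psi -> \tr (ketbra psi) = 1.
Proof. by move=> psi1; rewrite mxtrace_mulC trace_mx11 -dotmxE. Qed.

Lemma pure_stateN0 psi : pure_state psi -> psi != 0.
Proof. by move=> psi1; rewrite -dotmx_eq0 psi1 oner_eq0. Qed.

Lemma normalize_pure_state v : v != 0 ->
  exists a, a != 0 /\ exists2 phi, pure_state phi & v = a *: phi.
Proof.
move=> v0; set a := sqrtC (dotmx v v).
have a0 : a != 0 by rewrite sqrtC_eq0 dotmx_eq0.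
exists a; split=> //; exists (a^-1 *: v); last by rewrite scalerA divff ?scale1r.
rewrite /pure_state dotmxZZ ger0_norm ?invr_ge0 ?sqrtC_ge0 ?dotmx_ge0 //.
by rewrite exprVn sqrtCK mulVf // dotmx_eq0.
Qed.

Lemma sub_pure (m p : nat) (A : 'M[C]_(m, n)) (B : 'M[C]_(p, n)) :
  (forall phi, pure_state phi -> (phi <= A)%MS -> (phi <= B)%MS) ->
  (A <= B)%MS.
Proof.
move=> AB; apply/row_subP => i.
have [->|/normalize_pure_state[a [a0 [phi p1 e]]]] := eqVneq (row i A) 0.
  exact: sub0mx.
rewrite e scalemx_sub // AB //.
have -> : phi = a^-1 *: row i A by rewrite e scalerA mulVf ?scale1r.
by rewrite scalemx_sub // row_sub.
Qed.

Lemma pure_in (m : nat) (A : 'M[C]_(m, n)) : A != 0 ->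
  exists2 phi, pure_state phi & (phi <= A)%MS.
Proof.
move=> A0; apply: contrapT => noA; move/negP: A0; apply.
rewrite -submx0; apply: sub_pure => phi p1 pA.
by case: noA; exists phi.
Qed.

(** With [A] and [B] the Gram matrices of [T] and [S], the inclusion gives [T = W *m S], and the
    squared Hilbert-Schmidt norm of [W] is a possible constant. *)
Lemma psdmx_dominated A B : psdmx A -> psdmx B -> (A <= B)%MS ->
  exists2 c : R, 0 < c & psdmx (c%:C *: B - A).
Proof.
move=> /psdmx_factor[T eA sT] /psdmx_factor[S eB sS] AB.
have /submxP[W eT] : (T <= S)%MS.
  apply: submx_trans sT _; apply: submx_trans (supp_sub A) _.
  by apply: submx_trans AB _; rewrite eB submxMl.
have t0 : 0 <= \tr (W *m W^t*).
  rewrite sumr_ge0 // => i _; rewrite mxE sumr_ge0 // => j _.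
  by rewrite !mxE mul_conjC_ge0.
(* The added 1 keeps the constant strictly positive even when [W] is 0. *)
have : 0 < \tr (W *m W^t*) + 1 by rewrite ltr_wpDl.
have : \tr (W *m W^t*) <= \tr (W *m W^t*) + 1 by rewrite lerDl.
case: (_ + 1) => c d le_t; rewrite ltcE /= => /andP[/eqP d0 c0].
exists c => // v; rewrite qformB qformZ subr_ge0.
rewrite eA eB !qform_gram eT trmxC_mul mulmxA.
apply: le_trans (dotmx_mul_le _ _) _.
by apply: ler_wpM2r; [exact: dotmx_ge0|rewrite d0 in le_t].
Qed.

Lemma psdmx_ker A v : psdmx A -> dotmx (v *m A) v = 0 -> v *m A = 0.
Proof.
move=> /psdmx_factor[S -> _]; rewrite qform_gram => /eqP.
by rewrite dotmx_eq0 mulmxA => /eqP ->; rewrite mul0mx.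
Qed.

(** The row space of a Hermitian matrix is the orthogonal complement of its kernel. *)
Lemma herm_sub A B : A^t* = A -> B^t* = B ->
  (forall v, v *m B = 0 -> v *m A = 0) -> (A <= B)%MS.
Proof.
move=> hA hB kBA; rewrite submxE -(trmxCK (A *m _)) trmxC_mul hA.
suff -> : (cokermx B)^t* *m A = 0 by rewrite trmx0 map_mx0.
apply/row_matrixP => i; rewrite row_mul kBA ?row0 // -row_mul.
by rewrite -[X in _ *m X]hB -trmxC_mul mulmx_coker trmx0 map_mx0 row0.
Qed.

Lemma psdmx_sub A B : psdmx A -> psdmx B -> psdmx (B - A) -> (A <= B)%MS.
Proof.
move=> pA pB pBA; apply: herm_sub; try exact: psdmx_herm.
move=> v vB; apply: psdmx_ker => //; apply/eqP; rewrite eq_le pA andbT.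
by have := pBA v; rewrite qformB subr_ge0 vB [dotmx 0 v]dotmxE mul0mx mxE.
Qed.

Lemma qform_le_trace A v : psdmx A ->
  dotmx (v *m A) v <= \tr A * dotmx v v.
Proof.
move=> /psdmx_factor[S -> _]; rewrite qform_gram mxtrace_mulC.
exact: dotmx_mul_le.
Qed.

Lemma psdmx_trace_ge0 A : psdmx A -> 0 <= \tr A.
Proof.
move=> /psdmx_factor[S -> _]; rewrite sumr_ge0 // => i _; rewrite mxE.
by rewrite sumr_ge0 // => j _; rewrite !mxE mulrC mul_conjC_ge0.
Qed.

End PositiveSemidefinite.

(** * Positive maps and boundedness of their orbits *)

Section PositiveMaps.
Context {R : realType} {n : nat}.
Local Notation C := R[i].
Implicit Types (A B w X : 'M[C]_n) (v : 'rV[C]_n).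

Definition positive_map (E : 'M[C]_n -> 'M[C]_n) : Prop :=
  forall A, psdmx A -> psdmx (E A).

Lemma psdmx_cast m p (e : m = p) (M : 'M[C]_m) :
  psdmx (castmx (e, e) M) <-> psdmx M.
Proof. by case: p / e; rewrite castmx_id. Qed.

(** The case [k = 1] of the ampliation, up to a cast between equal dimensions. *)
Lemma completely_positive_positive (E : 'M[C]_n -> 'M[C]_n) :
  completely_positive E -> positive_map E.
Proof.
move=> cpE A pA.
have block1 (B : 'M[C]_n) : psdmx (\mxblock_(i < 1, j < 1) B) <-> psdmx B.
  by rewrite [in X in _ <-> X](mxEmxblock B) psdmx_cast.
have := cpE 1%N _ ((block1 A).2 pA); rewrite /ampliation.
have -> : \mxblock_(i < 1, j < 1) E (submxblock (\mxblock_(_ < 1, _ < 1) A) i j)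
        = \mxblock_(i < 1, j < 1) E A.
  by apply: eq_mxblock => i j; rewrite mxblockK.
by move=> /block1.
Qed.

(** Inclusion of supports amounts to domination up to a positive factor, which a positive linear map
    preserves. *)
Lemma positive_map_mono (E : {linear 'M[C]_n -> 'M[C]_n}) A B :
  positive_map E -> psdmx A -> psdmx B -> (A <= B)%MS -> (E A <= E B)%MS.
Proof.
move=> pE pA pB /(psdmx_dominated pA pB)[c c0 /pE]; rewrite linearB linearZ.
move=> pD; apply: submx_trans (psdmx_sub (pE _ pA) _ pD) _.
  by apply: psdmxZ (pE _ pB); rewrite lecR ltW.
exact: scalemx_sub.
Qed.

Lemma psdmx_iter (E : 'M[C]_n -> 'M[C]_n) A i :
  positive_map E -> psdmx A -> psdmx (iter i E A).
Proof. by move=> pE pA; elim: i => [|i IH]; [exact: pA | exact: pE]. Qed.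

Lemma mxtrace_iter (E : 'M[C]_n -> 'M[C]_n) A i :
  trace_preserving E -> \tr (iter i E A) = \tr A.
Proof. by move=> tE; elim: i => [//|i IH]; rewrite iterS tE. Qed.

Lemma iterD (E : {linear 'M[C]_n -> 'M[C]_n}) A B i :
  iter i E (A + B) = iter i E A + iter i E B.
Proof. by elim: i => //= i ->; rewrite linearD. Qed.

Lemma iterZ (E : {linear 'M[C]_n -> 'M[C]_n}) a A i :
  iter i E (a *: A) = a *: iter i E A.
Proof. by elim: i => //= i ->; rewrite linearZ. Qed.

(** Expanding the products leaves power sums of ['i] that vanish except in front of [w]. Every
    matrix is thus a combination of four positive ones, and linear estimates need only be proved for
    positive matrices. *)
Lemma polarization_gram w :
  4%:R *: w =
  \sum_(k < 4) 'i ^+ k *: ((w + 'i ^+ k *: 1%:M)^t* *m (w + 'i ^+ k *: 1%:M)).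
Proof.
have i2 : 'i ^+ 2 = -1 :> C by exact: sqrCi.
have i3 : 'i ^+ 3 = - 'i :> C by rewrite exprS i2 mulrN1.
have norm1 k : ('i : C) ^+ k * ('i ^+ k)^*%R = 1.
  by rewrite -normCK normrX normCi !expr1n.
have gram (a : C) : a * a^*%R = 1 -> a *: ((w + a *: 1%:M)^t* *m (w + a *: 1%:M)) =
    a *: (w^t* *m w) + a ^+ 2 *: w^t* + 1 *: w + a *: 1%:M.
  move=> a1; rewrite trmxCD trmxCZ trmx1 map_mx1 mulmxDl !mulmxDr -!scalemxAl.
  by rewrite -!scalemxAr mul1mx !mulmx1 !scalerDr !scalerA !addrA a1 mul1r.
under eq_bigr => k _ do rewrite gram //.
rewrite !big_split /= -!scaler_suml.
rewrite !big_ord_recr !big_ord0 /= expr0 expr1 i2 i3.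
rewrite (_ : 0 + 1 + 'i - 1 - 'i = 0); last by ring.
rewrite (_ : 0 + 1 ^+ 2 - 1 + (-1) ^+ 2 + (- 'i) ^+ 2 = 0).
  by rewrite !scale0r !add0r addr0; congr (_ *: _); ring.
by rewrite [(- 'i) ^+ 2]sqrrN i2; ring.
Qed.

Lemma real_archi_le0 (x k : R) : (forall N, N%:R * x <= k) -> x <= 0.
Proof.
move=> le_k; rewrite leNgt; apply/negP => x0.
have k0 : 0 <= k by have := le_k 0; rewrite mul0r.
have := archi_boundP (divr_ge0 k0 (ltW x0)).
by rewrite ltr_pdivrMr // ltNge le_k.
Qed.

(** Replaces a passage to the limit: dividing by [N] makes the bounded error negligible. Since
    [0 <= s] includes that [s] is real, the imaginary part must be shown to vanish too. *)
Lemma archi_ge0 (s c : C) :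
  (forall N, exists2 d : C, `|d| <= c & 0 <= N%:R * s + d) -> 0 <= s.
Proof.
case: s c => a b [c c'] sd.
have {}sd N : N%:R * - a <= c /\ `|N%:R * b| <= c.
  (* Multiplying [d] by the imaginary unit moves its imaginary part into the real part, so a bound
     on real parts serves for both. *)
  have [d dc] := sd N; have dc' : `|(0 +i* 1) * d| <= c +i* c'.
    by rewrite normrM [`|_ +i* _|]normCi mul1r.
  have := le_trans (normc_ge_Re _) dc; have := le_trans (normc_ge_Re _) dc'.
  case: d {dc dc'} => x y; rewrite -(rmorph_nat (@real_complex R)).
  rewrite !lecE /= !mul0r mul1r sub0r normrN addr0 subr0.
  move=> /andP[_ yc] /andP[_ xc] /andP[/eqP eb ea]; split.
    rewrite mulrN lerNl; apply: le_trans (_ : - x <= _).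
      by rewrite lerN2 (le_trans (ler_norm _)).
    by rewrite -subr_ge0 opprK.
  by rewrite (_ : _ * b = - y) ?normrN //; apply/eqP; rewrite -addr_eq0 eb.
have a0 : 0 <= a.
  by rewrite -oppr_le0; apply: (@real_archi_le0 _ c) => N; have [] := sd N.
have b0 : `|b| <= 0.
  apply: (@real_archi_le0 _ c) => N; have [_] := sd N.
  by rewrite normrM normr_nat.
by rewrite lecE /= a0 andbT -normr_le0.
Qed.

(** For a positive [w] the form is bounded by the trace, which is constant along the orbit;
    polarisation extends this to all [w]. *)
Lemma qform_iter_bounded (E : {linear 'M[C]_n -> 'M[C]_n}) w v :
  positive_map E -> trace_preserving E ->
  exists c, forall N, `|dotmx (v *m iter N E w) v| <= c.
Proof.
move=> pE tE; pose P (w : 'M[C]_n) :=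
  exists c, forall N, `|dotmx (v *m iter N E w) v| <= c.
have PD A B : P A -> P B -> P (A + B).
  move=> [a Pa] [b Pb]; exists (a + b) => N; rewrite iterD qformD.
  by apply: le_trans (ler_normD _ _) _; apply: lerD.
have PZ a A : P A -> P (a *: A).
  move=> [c Pc]; exists (`|a| * c) => N; rewrite iterZ qformZ normrM.
  by apply: ler_wpM2l.
have Ppsd A : psdmx A -> P A.
  move=> pA; exists (\tr A * dotmx v v) => N.
  have pN := psdmx_iter N pE pA.
  by rewrite ger0_norm ?pN // -(mxtrace_iter A N tE) qform_le_trace.
have -> : w = 4%:R^-1 *: (4%:R *: w) by rewrite scalerA mulVf ?scale1r ?pnatr_eq0.
apply: (PZ); rewrite polarization_gram; elim/big_ind: _ => // [|k _].
  by apply: Ppsd => u; rewrite mulmx0 dotmxE mul0mx mxE.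
by apply: PZ; apply: Ppsd; apply: psdmx_gram.
Qed.

End PositiveMaps.

(** * The ergodic limit of an orbit *)

(** The hypothesis says that the kernel and the image of [T] meet in 0; as their ranks add up to
    [m], they span the whole space. *)
Lemma ker_im_decomposition (F : fieldType) m (T : 'M[F]_m) :
  (forall x : 'rV_m, x *m T *m T = 0 -> x *m T = 0) ->
  forall y : 'rV_m, exists z w, y = z + w *m T /\ z *m T = 0.
Proof.
move=> TT y.
have capT : (kermx T :&: T)%MS = 0.
  apply/eqP; rewrite -submx0; apply/rV_subP => x; rewrite sub_capmx.
  by move=> /andP[/sub_kermxP xT /submxP[z ez]]; rewrite ez TT ?sub0mx // -ez.
have : (y <= kermx T + T)%MS.
  apply: submx_trans (submx1 _) _; rewrite sub1mx /row_full.
  by rewrite (mxrank_disjoint_sum capT) mxrank_ker subnK ?rank_leq_row.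
case/sub_addsmxP=> -[z w] /= ->; exists (z *m kermx T), w; split=> //.
by rewrite -mulmxA mulmx_ker mulmx0.
Qed.

Section Ergodic.
Context {R : realType} {n : nat}.
Local Notation C := R[i].
Context (E : {linear 'M[C]_n -> 'M[C]_n}).
Context (pE : positive_map E) (tE : trace_preserving E).

(* [E] has no Jordan block of size 2 for the eigenvalue 1, since along such a
   block [iter N E] would grow linearly. *)
Lemma im_subr_id_fixed w : E (E w - w) = E w - w -> E w = w.
Proof.
move=> fix_u; apply/eqP; rewrite -subr_eq0; apply/eqP; move: fix_u.
set u := E w - w => fix_u.
have eEw : E w = u + w by rewrite subrK.
have iterN N : iter N E w = w + N%:R *: u.
  elim: N => [|N IH]; first by rewrite scale0r addr0.
  rewrite iterS IH linearD linearZ /= fix_u eEw -natr1 scalerDl scale1r.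
  by rewrite [u + w]addrC -addrA (addrC u).
apply: quadratic_form_eq0 => v.
have [c ub] := qform_iter_bounded w v pE tE.
have ge0 (b : C) : `|b| = 1 -> 0 <= b * dotmx (v *m u) v.
  move=> b1; apply: (@archi_ge0 _ _ (c + c)) => N.
  (* With this bounded error the quantity to be compared with 0 is exactly 0. Taking [b] to be 1 and
     -1 then gives both signs for the form of [u]. *)
  exists (- b * (dotmx (v *m iter N E w) v - dotmx (v *m w) v)).
    rewrite normrM normrN b1 mul1r.
    by apply: le_trans (ler_normB _ _) _; apply: lerD (ub N) (ub 0).
  have -> : dotmx (v *m iter N E w) v = dotmx (v *m w) v + N%:R * dotmx (v *m u) v.
    by rewrite iterN qformD qformZ.
  by rewrite addrAC subrr add0r mulNr mulrCA subrr.
have := ge0 (-1) (normrN1 _); have := ge0 1 (normr1 _).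
by rewrite mul1r mulN1r oppr_ge0 => q0 q1; apply/eqP; rewrite eq_le q1 q0.
Qed.

(** The kernel-image decomposition for [E - 1], seen as a matrix acting on vectorised operators. *)
Lemma ergodic_decomposition A :
  exists s w, A = s + (E w - w) /\ E s = s.
Proof.
pose T := lin_mx E - 1%:M.
have mulT (x : 'M[C]_n) : mxvec x *m T = mxvec (E x - x).
  by rewrite mulmxBr mulmx1 mul_vec_lin linearB.
have [|z [w [eA zT]]] := @ker_im_decomposition _ _ T _ (mxvec A).
  move=> x; rewrite -(vec_mxK x); set y := vec_mx x; rewrite !mulT.
  rewrite -(linear0 mxvec) => /(can_inj mxvecK).
  move=> /eqP; rewrite subr_eq0 => /eqP /im_subr_id_fixed ->.
  by rewrite subrr.
exists (vec_mx z), (vec_mx w); split.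
  by apply: (can_inj mxvecK); rewrite linearD /= vec_mxK -mulT vec_mxK.
move: zT; rewrite -{1}(vec_mxK z) mulT -(linear0 mxvec) => /(can_inj mxvecK) /eqP.
by rewrite subr_eq0 => /eqP.
Qed.

(** [s] is the fixed component of [A], in effect the limit of the Cesaro means of its orbit; it
    inherits the closed conditions satisfied along the orbit. *)
Lemma ergodic_limit A : psdmx A ->
  exists s, [/\ psdmx s, \tr s = \tr A, E s = s &
    forall X : 'M[C]_n, (forall i, (iter i E A <= X)%MS) -> (s <= X)%MS].
Proof.
move=> pA; have [s [w [eA fs]]] := ergodic_decomposition A.
(* The component [E w - w] telescopes along the orbit. *)
have cesaro N : \sum_(i < N) iter i E A = N%:R *: s + (iter N E w - w).
  elim: N => [|N IH]; first by rewrite big_ord0 scale0r subrr addr0.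
  rewrite big_ord_recr IH /= eA iterD.
  have -> : iter N E s = s by elim: N {IH} => //= N ->.
  rewrite -scaleN1r iterD iterZ scaleN1r -iterSr /= -natr1 scalerDl scale1r.
  by rewrite addrACA scaleN1r; congr (_ + _); rewrite addrC addrA subrK.
(* The sign [b] allows two uses: 1 for the positivity of [s], and -1 to make its form vanish where
   that of the whole orbit does. *)
have key v (b : C) : `|b| = 1 ->
    (forall i, 0 <= b * dotmx (v *m iter i E A) v) -> 0 <= b * dotmx (v *m s) v.
  move=> b1 pos; have [c ub] := qform_iter_bounded w v pE tE.
  apply: (@archi_ge0 _ _ (c + c)) => N.
  exists (b * (dotmx (v *m iter N E w) v - dotmx (v *m w) v)).
    rewrite normrM b1 mul1r.
    by apply: le_trans (ler_normB _ _) _; apply: lerD (ub N) (ub 0).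
  have eq_sum : \sum_(i < N) dotmx (v *m iter i E A) v =
      N%:R * dotmx (v *m s) v +
      (dotmx (v *m iter N E w) v - dotmx (v *m w) v).
    rewrite -qformB -qformZ -qformD -cesaro dotmxE mulmx_sumr mulmx_suml summxE.
    by apply: eq_bigr => i _; rewrite dotmxE.
  by rewrite mulrCA -mulrDr -eq_sum mulr_sumr sumr_ge0.
have ps : psdmx s.
  move=> v; have pos i : 0 <= 1 * dotmx (v *m iter i E A) v.
    by rewrite mul1r; exact: (psdmx_iter i pE pA v).
  by have := key v 1 (normr1 _) pos; rewrite mul1r.
exists s; split=> //.
  by rewrite eA mxtraceD linearB /= tE subrr addr0.
(* The orbit vanishes on the orthogonal complement of [X], hence so does the form of [s]; by
   positivity [s] itself vanishes there. *)
move=> X sX; have Ks : (X^!)%MS *m s = 0.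
  apply/row_matrixP => k; rewrite row_mul row0; apply: psdmx_ker => //.
  have K0 i : row k X^!%MS *m iter i E A = 0.
    have hi := psdmx_herm (psdmx_iter i pE pA).
    by rewrite -row_mul (ortho_mul_herm hi (sX i)) row0.
  have kq b i : 0 <= b * dotmx (row k X^!%MS *m iter i E A) (row k X^!%MS).
    by rewrite K0 dotmxE mul0mx mxE mulr0.
  have := key (row k X^!%MS) (-1) (normrN1 _) (kq _).
  by rewrite mulN1r oppr_ge0 => q; apply/eqP; rewrite eq_le q ps.
rewrite -(ortho_id X); apply/orthomx1P.
by rewrite -(psdmx_herm ps) -trmxC_mul Ks trmx0 map_mx0.
Qed.

End Ergodic.

(** * Images of subspaces, invariance and reachable spaces *)

Section Reachability.
Context {R : realType} {n : nat}.
Local Notation C := R[i].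
Implicit Types (A X Y Z rho sigma : 'M[C]_n) (phi psi : 'rV[C]_n).

Lemma superop_image_sub (F : 'M[C]_n -> 'M[C]_n) X Y :
  (forall psi, pure_state psi -> (psi <= X)%MS ->
     (supp (F (ketbra psi)) <= Y)%MS) ->
  (superop_image F X <= Y)%MS.
Proof.
move=> XY; have [_] := mxspanP (fun v : 'rV[C]_n =>
  exists2 psi, pure_state psi /\ (psi <= X)%MS & (v <= supp (F (ketbra psi)))%MS).
by apply=> v [psi [p1 pX] /submx_trans]; apply; apply: XY.
Qed.

Lemma supp_superop_image (F : 'M[C]_n -> 'M[C]_n) X psi :
  pure_state psi -> (psi <= X)%MS ->
  (supp (F (ketbra psi)) <= superop_image F X)%MS.
Proof.
move=> p1 pX; apply/row_subP => i; have [+ _] := mxspanP (fun v : 'rV[C]_n =>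
  exists2 psi, pure_state psi /\ (psi <= X)%MS & (v <= supp (F (ketbra psi)))%MS).
by apply; exists psi => //; exact: row_sub.
Qed.

Lemma pure_state_reachable K F psi phi : pure_state phi ->
  path_between K F (ketbra psi) (ketbra phi) -> (phi <= reachable K F psi)%MS.
Proof.
move=> p1 path; have [+ _] := mxspanP (fun phi : 'rV[C]_n =>
  pure_state phi /\ path_between K F (ketbra psi) (ketbra phi)).
exact.
Qed.

Lemma reachable_le K F psi Y :
  (forall phi, pure_state phi -> path_between K F (ketbra psi) (ketbra phi) ->
    (phi <= Y)%MS) -> (reachable K F psi <= Y)%MS.
Proof.
move=> pY; have [_] := mxspanP (fun phi : 'rV[C]_n =>
  pure_state phi /\ path_between K F (ketbra psi) (ketbra phi)).
by apply=> v [v1 /pY]; apply.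
Qed.

Lemma density_on_ketbra K psi : pure_state psi -> (psi <= K)%MS ->
  density_on K (ketbra psi).
Proof.
move=> p1 pK; split; first by split; [exact: psdmx_ketbra | exact: mxtrace_ketbra].
by apply: submx_trans (supp_sub _) _; apply: submx_trans (ketbra_sub _) _.
Qed.

Lemma self_reachable K F psi : pure_state psi -> (psi <= K)%MS ->
  (psi <= reachable K F psi)%MS.
Proof.
move=> p1 pK; apply: pure_state_reachable => //.
exists 0%N, (fun=> ketbra psi); split=> // i _; exact: density_on_ketbra.
Qed.

Lemma gram_ketbra (S : 'M[C]_n) : S^t* *m S = \sum_i ketbra (row i S).
Proof.
apply/matrixP => i j; rewrite summxE mxE; apply: eq_bigr => k _.
by rewrite !mxE big_ord1 !mxE.
Qed.

Context (E : {linear 'M[C]_n -> 'M[C]_n}).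
Context (pE : positive_map E) (tE : trace_preserving E).

Lemma image_ketbra_sub X psi : (psi <= X)%MS ->
  (E (ketbra psi) <= superop_image E X)%MS.
Proof.
move=> pX; have [->|/normalize_pure_state[a [a0 [phi p1 e]]]] := eqVneq psi 0.
  by rewrite /ketbra mulmx0 linear0 sub0mx.
have -> : ketbra psi = (`|a| ^+ 2) *: ketbra phi.
  by rewrite /ketbra e trmxCZ -scalemxAl -scalemxAr scalerA normCKC.
rewrite linearZ scalemx_sub // -(eqmx_supp (pE (psdmx_ketbra phi))).
apply: supp_superop_image => //.
have -> : phi = a^-1 *: psi by rewrite e scalerA mulVf ?scale1r.
exact: scalemx_sub.
Qed.

(** The image of a subspace is defined through pure states; a positive matrix is a sum of [ketbra]s
    of vectors in its support, so linearity suffices. *)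
Lemma image_sub X A : psdmx A -> (A <= X)%MS -> (E A <= superop_image E X)%MS.
Proof.
move=> /psdmx_factor[S eA /submx_trans sS] AX.
have {}sS : (S <= X)%MS by apply: sS; apply: submx_trans (supp_sub _) AX.
rewrite eA gram_ketbra linear_sum summx_sub // => i _.
by apply: image_ketbra_sub; apply: submx_trans (row_sub _ _) sS.
Qed.

Lemma invariant_image X A : invariant_space E X ->
  psdmx A -> (A <= X)%MS -> (E A <= X)%MS.
Proof. by move=> iX pA AX; apply: submx_trans (image_sub pA AX) iX. Qed.

Lemma invariant_iter X A i : invariant_space E X ->
  psdmx A -> (A <= X)%MS -> (iter i E A <= X)%MS.
Proof.
move=> iX pA AX; elim: i => [//|i IH].
exact: invariant_image iX (psdmx_iter i pE pA) IH.
Qed.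

Lemma restriction_invariant X Z A : invariant_space E X -> (X <= Z)%MS ->
  psdmx A -> (A <= X)%MS -> restriction Z E A = E A.
Proof.
move=> iX XZ pA AX; have EZ := submx_trans (invariant_image iX pA AX) XZ.
have hE := psdmx_herm (pE pA).
by rewrite /restriction (herm_mul_proj_ortho hE EZ) (proj_ortho_id EZ).
Qed.

(** Inside an invariant subspace the projection in the restricted map does nothing, so restricted
    and original images agree. *)
Lemma superop_image_restriction X Y Z : invariant_space E X -> (X <= Z)%MS ->
  (Y <= X)%MS -> superop_image (restriction Z E) Y = superop_image E Y.
Proof.
move=> iX XZ YX.
have eE psi : (psi <= Y)%MS ->
    restriction Z E (ketbra psi) = E (ketbra psi).
  move=> pY; apply: (restriction_invariant iX XZ (psdmx_ketbra _)).
  by apply: submx_trans (ketbra_sub _) (submx_trans pY YX).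
rewrite /superop_image; apply: congr1; apply/predeqP => v.
split=> -[psi [p1 pY] vs]; exists psi; first [exact: (conj p1 pY) | move: vs];
  by rewrite (eE _ pY).
Qed.

Lemma superop_imageS (F : 'M[C]_n -> 'M[C]_n) X Y : (X <= Y)%MS ->
  (superop_image F X <= superop_image F Y)%MS.
Proof.
move=> XY; apply: superop_image_sub => psi p1 pX.
by apply: supp_superop_image => //; apply: submx_trans pX XY.
Qed.

(** By induction along a path, the supports never leave [X]. The ambient [Z] may be larger than [X],
    as both directions of the theorem require. *)
Lemma reachable_sub_invariant X Z psi :
  invariant_space E X -> (X <= Z)%MS -> pure_state psi -> (psi <= X)%MS ->
  (reachable Z (restriction Z E) psi <= X)%MS.
Proof.
move=> iX XZ p1 pX; apply: reachable_le => phi q1 [l [s [s0 sl dens step]]].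
have sX i : (i <= l)%N -> (supp (s i) <= X)%MS.
  elim: i => [_|i IH il].
    by rewrite s0; have [] := density_on_ketbra p1 pX.
  apply: submx_trans (step i il) _.
  rewrite (superop_image_restriction iX XZ (IH (ltnW il))).
  exact: submx_trans (superop_imageS E (IH (ltnW il))) iX.
apply: submx_trans (sub_ketbra q1) _.
by rewrite -(eqmx_supp (psdmx_ketbra phi)) -sl sX.
Qed.

Lemma iter_sub_reachable X psi i :
  invariant_space E X -> pure_state psi -> (psi <= X)%MS ->
  (iter i E (ketbra psi) <= reachable X (restriction X E) psi)%MS.
Proof.
move=> iX p1 pX; have pk := psdmx_ketbra psi.
have kX : (ketbra psi <= X)%MS := submx_trans (ketbra_sub psi) pX.
have [s es] : {s | forall j, iter j E (ketbra psi) = s j}.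
  by exists (fun j => iter j E (ketbra psi)).
have s0 : s 0 = ketbra psi by rewrite -es.
have sS j : s j.+1 = E (s j) by rewrite -!es.
have ps j : psdmx (s j) by rewrite -es; exact: psdmx_iter.
have sX j : (s j <= X)%MS by rewrite -es; exact: invariant_iter.
have trs j : \tr (s j) = 1 by rewrite -es mxtrace_iter // mxtrace_ketbra.
rewrite {}es; case: i => [|i].
  by rewrite s0; apply: submx_trans (ketbra_sub _) (self_reachable _ p1 pX).
apply: sub_pure => phi q1 phiS; apply: pure_state_reachable => //.
have phiX : (phi <= X)%MS := submx_trans phiS (sX i.+1).
(* The path follows the orbit up to index [i], then jumps to [phi] in place of the orbit's state of
   index [i.+1], whose support contains [phi]. *)
exists i.+1, (fun j => if (j <= i)%N then s j else ketbra phi).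
split; [exact: s0 | by rewrite ltnn | move=> j _ | move=> j].
  case: ifP => _; last exact: density_on_ketbra q1 phiX.
  exact: (conj (conj (ps j) (trs j)) (submx_trans (supp_sub _) (sX j))).
rewrite ltnS => ji; rewrite ji.
have sjX : (supp (s j) <= X)%MS := submx_trans (supp_sub _) (sX j).
rewrite (superop_image_restriction iX (submx_refl X) sjX).
apply: submx_trans (supp_sub _) _.
have im : (s j.+1 <= superop_image E (supp (s j)))%MS.
  by rewrite sS; apply: (image_sub (ps j)); rewrite (eqmx_supp (ps j)).
apply: submx_trans im; case: ifP => ij; first exact: submx_refl.
have -> : j = i by apply/eqP; rewrite eqn_leq ji leqNgt ij.
exact: submx_trans (ketbra_sub _) phiS.
Qed.

(** Pure states on a common line are multiples of each other, so paths of length 0 suffice. *)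
Lemma line_strongly_connected Y psi0 : (Y <= psi0)%MS -> strongly_connected E Y.
Proof.
move=> Yp phi psi p1 q1 pY qY.
have line u v : pure_state u -> pure_state v -> (u <= Y)%MS -> (v <= Y)%MS ->
    (u <= v)%MS.
  move=> u1 v1 /submx_trans-/(_ _ _ Yp)/sub_rVP[a ea].
  move=> /submx_trans-/(_ _ _ Yp)/sub_rVP[b eb].
  have b0 : b != 0.
    by apply: contraTneq (pure_stateN0 v1) => b0; rewrite eb b0 scale0r eqxx.
  by rewrite ea (_ : psi0 = b^-1 *: v) ?scalemx_sub // eb scalerA mulVf ?scale1r.
split.
  exact: submx_trans (line _ _ p1 q1 pY qY) (self_reachable _ q1 qY).
exact: submx_trans (line _ _ q1 p1 qY pY) (self_reachable _ p1 pY).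
Qed.

(** The zero subspace is not maximal: it lies in a line, which is strongly connected. *)
Lemma SCC_neq0 X : (0 < n)%N -> SCC E X -> X != 0.
Proof.
move=> n0 [_ maxX]; apply/negP => /eqP X0.
pose v : 'rV[C]_n := delta_mx 0 (Ordinal n0).
have /maxX : strongly_connected E <<v>>%MS.
  by apply: (@line_strongly_connected _ v); rewrite genmxE.
rewrite X0 => /(_ (sub0mx _ _)); rewrite genmxE submx0 => /eqP /rowP.
by move=> /(_ (Ordinal n0)); rewrite !mxE !eqxx => /eqP; rewrite oner_eq0.
Qed.

(** * Fixed point states *)

(** A pure state in the support is dominated by a multiple of [rho], hence so is its image under
    [E]. *)
Lemma invariant_supp_fixed rho : psdmx rho -> E rho = rho ->
  invariant_space E (supp rho).
Proof.
move=> pr fr; apply: superop_image_sub => psi p1 pr'.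
rewrite (eqmx_supp pr) in pr'.
rewrite (eqmx_supp pr) (eqmx_supp (pE (psdmx_ketbra psi))).
rewrite -[X in (_ <= X)%MS]fr.
apply: (positive_map_mono pE (psdmx_ketbra psi) pr).
exact: submx_trans (ketbra_sub psi) pr'.
Qed.

Lemma fixed_point_state_iter_span X psi : pure_state psi ->
  (forall i, (iter i E (ketbra psi) <= X)%MS) ->
  exists2 sigma, fixed_point_state E sigma & (supp sigma <= X)%MS.
Proof.
move=> p1 iX; have [s [ps ts fs sX]] := ergodic_limit pE tE (psdmx_ketbra psi).
rewrite mxtrace_ketbra // in ts; exists s; last by rewrite (eqmx_supp ps) sX.
split; [| by split; [exact: ps | rewrite ts] | exact: fs].
by apply: contraTneq (oner_neq0 C) => s0; rewrite -ts s0 mxtrace0 eqxx.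
Qed.

(* With [c] the largest real such that [sigma - c *: rho] is positive, this
   difference is fixed and its support is smaller than that of [rho]. *)
Lemma fixed_point_state_unique rho sigma :
  (forall tau, fixed_point_state E tau -> (supp tau <= supp sigma)%MS ->
     (supp rho <= supp tau)%MS) ->
  fixed_point_state E rho -> fixed_point_state E sigma ->
  eq_upto_scaling sigma rho.
Proof.
move=> full [rho0 [pr tr_r] fr] [sigma0 [psg tr_s] fs].
pose f v := complex.Re (dotmx (v *m sigma) v).
pose g v := complex.Re (dotmx (v *m rho) v).
have qE A v : psdmx A -> dotmx (v *m A) v = (complex.Re (dotmx (v *m A) v))%:C.
  by move=> /(_ v); rewrite lecE; case: (dotmx _ _) => a b /= /andP[/eqP -> _].
(* Positivity of the difference becomes a family of affine inequalities in the real number [c], so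
   it survives at the supremum. *)
have psdP (c : R) : psdmx (sigma - c%:C *: rho) <-> forall v, c * g v <= f v.
  split=> H v; have := H v; rewrite qformB qformZ subr_ge0 (qE _ _ psg) (qE _ _ pr);
  by rewrite -rmorphM lecR.
pose D (c : R) := psdmx (sigma - c%:C *: rho).
have D0 : D 0 by rewrite /D /= scale0r subr0.
have [v gv0] : exists v, 0 < g v.
  apply: contrapT => ng; case/eqP: rho0; apply: quadratic_form_eq0 => v.
  have := pr v; rewrite (qE _ _ pr) lecR le_eqVlt => /orP[/eqP <- //|gv].
  by case: ng; exists v.
have ubD w : 0 < g w -> ubound D (f w / g w).
  by move=> gw c /psdP/(_ w); rewrite ler_pdivlMr.
have supD : has_sup D by split; [exists 0 | exists (f v / g v); exact: ubD].
set c := sup D; have c0 : 0 <= c by exact: sup_upper_bound.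
set tau := sigma - c%:C *: rho.
have ptau : psdmx tau.
  apply/psdP => w; have := pr w; rewrite (qE _ _ pr) lecR le_eqVlt -/(g w).
  case/orP=> [/eqP <-|gw]; last first.
    by rewrite -ler_pdivlMr //; apply: ge_sup (ubD w gw); exists 0.
  by rewrite mulr0; have := psg w; rewrite (qE _ _ psg) lecR.
have ftau : E tau = tau by rewrite linearB linearZ /= fs fr.
have [tau0|tauN0] := eqVneq tau 0.
  have es : sigma = c%:C *: rho by apply/eqP; rewrite -subr_eq0 -/tau tau0.
  exists c%:C => //; rewrite ltcR lt_neqAle c0 andbT.
  by apply: contraNneq sigma0 => c0'; rewrite es -c0' scale0r.
have cr0 : psdmx (c%:C *: rho) by apply: (psdmxZ _ pr); rewrite lecR.
have fptau : fixed_point_state E tau.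
  split; [exact: tauN0 | split; [exact: ptau |] | exact: ftau].
  apply: le_trans tr_s.
  by rewrite raddfB /= gerBl psdmx_trace_ge0.
have tausig : (supp tau <= supp sigma)%MS.
  rewrite (eqmx_supp ptau) (eqmx_supp psg); apply: (psdmx_sub ptau psg).
  by rewrite opprB addrCA subrr addr0.
(* If [tau] is nonzero, its support contains that of [rho], so [d] times [tau] dominates [rho] for
   some [d > 0]; then [c + d^-1] still belongs to [D], beyond its supremum. *)
have := full _ fptau tausig; rewrite (eqmx_supp pr) (eqmx_supp ptau).
move=> /(psdmx_dominated pr ptau).
case=> d d0 dtau; have : D (c + d^-1).
  rewrite /D /= rmorphD /= scalerDl opprD addrA -/tau.
  have -> : tau - (d^-1)%:C *: rho = (d^-1)%:C *: (d%:C *: tau - rho).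
    have dd : (d^-1)%:C * d%:C = 1 :> C by rewrite -rmorphM mulVf ?gt_eqF.
    by rewrite scalerBr scalerA dd scale1r.
  by apply: (psdmxZ _ dtau); rewrite lecR invr_ge0 ltW.
by move=> /(sup_upper_bound supD); rewrite gerDl invr_le0 leNgt d0.
Qed.

(** * The two implications of the theorem *)

(** What is reachable from a pure state of [supp tau] stays in that invariant subspace, yet contains
    [X] by strong connectedness. *)
Lemma BSCC_fixed_point_full X : BSCC E X ->
  forall tau, fixed_point_state E tau -> (supp tau <= X)%MS -> (X <= supp tau)%MS.
Proof.
move=> [[scX _] _] tau [tau0 [ptau _] ftau] tauX.
have st0 : supp tau != 0 by rewrite -mxrank_eq0 (eqmx_supp ptau) mxrank_eq0.
have [psi p1 psi_tau] := pure_in st0.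
apply: sub_pure => phi q1 qX.
have [+ _] := scX phi psi q1 p1 qX (submx_trans psi_tau tauX).
move/submx_trans; apply.
exact: reachable_sub_invariant (invariant_supp_fixed ptau ftau) tauX p1 psi_tau.
Qed.

Lemma BSCC_minimal_fixed_point X : (0 < n)%N -> BSCC E X ->
  exists rho, minimal_fixed_point_state E rho /\ (supp rho == X)%MS.
Proof.
move=> n0 bX; have [sccX iX] := bX; have full := BSCC_fixed_point_full bX.
have [psi p1 pX] := pure_in (SCC_neq0 n0 sccX).
have kX : (ketbra psi <= X)%MS := submx_trans (ketbra_sub psi) pX.
have [|rho frho rhoX] := @fixed_point_state_iter_span X psi p1.
  by move=> i; apply: invariant_iter iX (psdmx_ketbra psi) kX.
exists rho; split; last by rewrite rhoX full.
split; first exact: frho.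
move=> sigma fsigma sigma_rho; apply: (fixed_point_state_unique _ frho fsigma).
move=> tau ftau tau_sigma; apply: (submx_trans rhoX (full _ ftau _)).
by apply: submx_trans tau_sigma (submx_trans sigma_rho rhoX).
Qed.

Lemma minimal_fixed_point_BSCC X rho :
  minimal_fixed_point_state E rho -> (supp rho == X)%MS -> BSCC E X.
Proof.
move=> [[rho0 [prho _] frho] minrho] /andP[rX Xr].
have iX : invariant_space E X.
  apply: submx_trans (superop_imageS E Xr) _.
  exact: submx_trans (invariant_supp_fixed prho frho) rX.
(* The orbit of [psi] yields a fixed point state supported in the reachable space; by minimality it
   is proportional to [rho], so its support is already [X]. *)
have reach psi : pure_state psi -> (psi <= X)%MS ->
    (X <= reachable X (restriction X E) psi)%MS.
  move=> p1 pX; have := iter_sub_reachable _ iX p1 pX.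
  case/(fixed_point_state_iter_span p1) => sigma fsigma sigmaW.
  have WX := reachable_sub_invariant iX (submx_refl X) p1 pX.
  have [c c0 es] := minrho _ fsigma (submx_trans sigmaW (submx_trans WX Xr)).
  apply: submx_trans Xr (submx_trans _ sigmaW).
  have [_ [psigma _] _] := fsigma.
  rewrite (eqmx_supp prho) (eqmx_supp psigma) es.
  have {1}-> : rho = c^-1 *: (c *: rho) by rewrite scalerA mulVf ?gt_eqF ?scale1r.
  exact: scalemx_sub.
split; last exact: iX.
split.
  move=> phi psi p1 q1 pX qX.
  by split; [apply: submx_trans pX _ | apply: submx_trans qX _]; apply: reach.
(* Maximality: from a pure state of [X], paths within [Y] cannot leave the invariant [X], yet they
   must span [Y]. *)
move=> Y scY XY; have X0 : X != 0.
  rewrite -mxrank_eq0 -lt0n; apply: leq_trans (mxrankS rX).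
  by rewrite (eqmx_supp prho) lt0n mxrank_eq0.
have [psi p1 pX] := pure_in X0; apply: sub_pure => phi q1 qY.
have [+ _] := scY phi psi q1 p1 qY (submx_trans pX XY).
move/submx_trans; apply; exact: reachable_sub_invariant iX XY p1 pX.
Qed.

End Reachability.

Theorem theorem2 (R : realType) (n : nat) (n_gt0 : (0 < n)%N)
    (E : {linear 'M[R[i]]_n -> 'M[R[i]]_n})
    (E_cp : completely_positive E) (E_tp : trace_preserving E)
    (X : 'M[R[i]]_n) :
  (BSCC E X <->
     exists rho : 'M[R[i]]_n,
       minimal_fixed_point_state E rho /\ (supp rho == X)%MS) /\
  (forall rho : 'M[R[i]]_n,
     minimal_fixed_point_state E rho -> (supp rho == X)%MS ->
     forall sigma : 'M[R[i]]_n,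
       fixed_point_state E sigma -> (supp sigma <= X)%MS ->
       eq_upto_scaling sigma rho).

Proof.
have pE := completely_positive_positive E_cp.
split; last first.
  move=> rho [_ minrho] /andP[_ Xr] sigma fsigma sX.
  exact: minrho fsigma (submx_trans sX Xr).
split; first exact: BSCC_minimal_fixed_point.
by case=> rho [minrho suppX]; exact: minimal_fixed_point_BSCC minrho suppX.
Qed.
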